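(* We have $s_{\le2}(1)=1$ and, for each integer $n\ge2$, $$s_{\le2}(n)=3\,s_{\le2}(n-1).$$ Consequently, for every $n\ge1$, $s_{\le2}(n)=3^{n-1}$ and $s_2(n)=s_{\le2}(n)-s_1(n)=3^{n-1}-1$.
   Context: $[m]=\{1,2,\dots,m\}$. A matching on $[2n]$ is a partition of $[2n]$ into $n$ two-element subsets, called edges. For a matching $M$ on $[2n]$ and $k\in[2n]$, let $x_k(M)$ be the number of edges of $M$ with one endpoint in $[k]$ and the other in $[2n]\setminus[k]$. The sock number of $M$ is $y(M)=\max_{1\le k\le 2n}x_k(M)$. Let $s_{\le j}(n)$ be the number of matchings $M$ on $[2n]$ with $y(M)\le j$, and let $s_j(n)$ be the number of matchings $M$ on $[2n]$ with $y(M)=j$. *)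

(* Defs.v *)
From mathcomp Require Import all_boot.
Set Implicit Arguments.
Unset Strict Implicit.
Unset Printing Implicit Defensive.

(* The ground set [2n] is 'I_(2 * n): the ordinal i : 'I_(2 * n) stands for   *)
(* the integer i + 1, so that membership of i + 1 in [k] reads i < k.         *)
Definition initial (n k : nat) : {set 'I_(2 * n)} :=
  [set i : 'I_(2 * n) | i < k].

(* The number n of edges is not imposed: it follows from the blocks being     *)
(* pairs.                                                                     *)
Definition is_matching (n : nat) (M : {set {set 'I_(2 * n)}}) : bool :=
  partition M [set: 'I_(2 * n)] && [forall e in M, #|e| == 2].

Definition crosses (n k : nat) (e : {set 'I_(2 * n)}) : bool :=
  [exists i in initial n k, exists j in ~: initial n k, e == [set i; j]].

Definition crossing_number (n k : nat) (M : {set {set 'I_(2 * n)}}) : nat :=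
  #|[set e in M | crosses k e]|.

Definition sock_number (n : nat) (M : {set {set 'I_(2 * n)}}) : nat :=
  \max_(1 <= k < (2 * n).+1) crossing_number k M.

Definition s_le (j n : nat) : nat :=
  #|[set M : {set {set 'I_(2 * n)}} | is_matching M & sock_number M <= j]|.

Definition s_eq (j n : nat) : nat :=
  #|[set M : {set {set 'I_(2 * n)}} | is_matching M & sock_number M == j]|.

(* Main.v *)
Require Import Defs.
From mathcomp Require Import all_boot all_order all_algebra.
From mathcomp Require Import zify.
Import GRing.Theory Num.Theory.

Set Implicit Arguments.
Unset Strict Implicit.
Unset Printing Implicit Defensive.

(** If [y(M) <= 2], the three points of [[3]] cannot lie on three distinct
    edges leaving [[3]], so some edge of [M] lies inside [[3]].  Deleting it and
    renumbering leaves a matching [M'] on two points fewer with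
    [x_k(M') = x_(k+2)(M)] for [k >= 1].  The edge can be any of the three pairs
    in [[3]], and [x_1, x_2 <= 2] always holds, so the deletion is three-to-one.
    If [y(M) <= 1], the same argument in [[2]] forces the edge [{1,2}], and the
    deletion is one-to-one. *)

(** * Matchings and crossings in pointwise form *)

Lemma matchingP (n : nat) (M : {set {set 'I_(2 * n)}}) :
  reflect [/\ forall e, e \in M -> #|e| = 2,
              forall x, exists2 e, e \in M & x \in e
            & forall e1 e2 x, e1 \in M -> e2 \in M ->
                x \in e1 -> x \in e2 -> e1 = e2]
          (is_matching M).
Proof.
apply: (iffP andP) => [[/and3P[/eqP covM tM _] /forall_inP M2]|[M2 cov uM]].
  split=> [e /M2/eqP // | x | e1 e2 x e1M e2M xe1 xe2].
    have /bigcupP[e eM xe] : x \in cover M by rewrite covM.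
    by exists e.
  by rewrite -(def_pblock tM e1M xe1) -(def_pblock tM e2M xe2).
split; last by apply/forall_inP => e /M2 ->.
apply/and3P; split.
- apply/eqP/setP=> x; rewrite inE; apply/bigcupP.
  by have [e] := cov x; exists e.
- apply/trivIsetP => e1 e2 e1M e2M; apply: contraNT => /pred0Pn[x /= /andP[x1 x2]].
  by apply/eqP; apply: uM x1 x2.
- by apply/negP => /M2; rewrite cards0.
Qed.

Lemma card_initial (n k : nat) : k <= 2 * n -> #|initial n k| = k.
Proof.
move=> lekn; have -> : initial n k = widen_ord lekn @: [set: 'I_k].
  apply/setP=> i; rewrite inE; apply/idP/imsetP => [ltik | [j _ ->] //=].
  by exists (Ordinal ltik) => //; apply: val_inj.
by rewrite card_imset ?cardsT ?card_ord // => i j /(congr1 val) /= /val_inj.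
Qed.

(** The exclusive or is symmetric, so no choice of the endpoint lying in [[k]] has to be carried
    along. *)
Lemma crosses_pair (n k : nat) (i j : 'I_(2 * n)) :
  crosses k [set i; j] = (i < k) (+) (j < k).
Proof.
apply/exists_inP/idP => [[a + /exists_inP[b]]|].
  rewrite !inE => ak bk /eqP ijab.
  have := set21 a b; have := set22 a b; rewrite -ijab !inE.
  by move=> /orP[] /eqP Eb /orP[] /eqP Ea; move: ak bk; rewrite Ea Eb;
     case: (i < k); case: (j < k).
case: (boolP (i < k)) => ik; case: (boolP (j < k)) => jk //= _.
  by exists i; rewrite ?inE //; apply/exists_inP; exists j; rewrite ?inE.
exists j; rewrite ?inE //; apply/exists_inP; exists i; rewrite ?inE //.
by rewrite setUC.
Qed.

(** Outside [1 <= k <= 2 * n] one side of the cut is empty and nothing crosses, so the bound can be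
    quantified over every [k]. *)
Lemma sock_numberP (n j : nat) (M : {set {set 'I_(2 * n)}}) :
  reflect (forall k, crossing_number k M <= j) (sock_number M <= j).
Proof.
apply: (iffP idP) => [le_j k | le_j]; last first.
  by rewrite /sock_number; elim/big_ind: _ => // x y; rewrite geq_max => -> ->.
have [kI|kI] := boolP (1 <= k < (2 * n).+1).
  apply: leq_trans le_j; rewrite /sock_number.
  by apply: (bigmaxn_sup_seq k); rewrite ?mem_index_iota.
rewrite (_ : crossing_number k M = 0) //; apply/eqP; rewrite cards_eq0.
apply/eqP/setP => e; rewrite !inE; apply/negP => /andP[_].
case/exists_inP=> a + /exists_inP[b]; rewrite !inE => ak bk _.
by have := ltn_ord b; lia.
Qed.

(** * Bounds on cuts, and edges inside an initial segment *)

Section Crossings.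

Variables (n : nat) (M : {set {set 'I_(2 * n)}}).
Hypothesis matchM : is_matching M.

(** Each crossing edge is the block of its endpoint in [[k]], so [pblock M] maps [[k]] onto a set
    containing all of them. *)
Lemma crossing_number_le (k : nat) : k <= 2 * n -> crossing_number k M <= k.
Proof.
move=> lekn; have /andP[/and3P[_ tM _] _] := matchM.
rewrite -{2}(card_initial lekn).
apply: leq_trans (leq_imset_card (pblock M) _).
apply/subset_leq_card/subsetP => e; rewrite inE => /andP[eM].
case/exists_inP=> i ik /exists_inP[j _ /eqP Ee]; apply/imsetP; exists i => //.
by rewrite (def_pblock tM eM) // Ee set21.
Qed.

Lemma crossing_number_le_edges (k : nat) : crossing_number k M <= n.
Proof.
have /andP[pM /forall_inP M2] := matchM.
have := card_uniform_partition (fun e eM => eqP (M2 e eM)) pM.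
rewrite cardsT card_ord => E; have leM : #|M| <= n by lia.
by apply: leq_trans leM; apply/subset_leq_card/subsetP => e; rewrite inE => /andP[].
Qed.

(** By contraposition: if no edge lies inside [[k]], then every point of [[k]] has its partner
    outside, so [pblock M] is injective on [[k]] with crossing values, giving at least [k] crossing
    edges. *)
Lemma edge_in_initial (k : nat) :
  k <= 2 * n -> crossing_number k M < k ->
  exists2 e, e \in M & e \subset initial n k.
Proof.
move=> lekn ltk; have /matchingP[M2 cov uM] := matchM.
have /andP[/and3P[/eqP covM tM _] _] := matchM.
apply/exists_inP; apply: contraLR ltk; rewrite negb_exists_in -leqNgt.
move=> /forall_inP noedge.
have blkM i : pblock M i \in M by rewrite pblock_mem // covM.
have iblk i : i \in pblock M i by rewrite mem_pblock covM.
have blkE i j : i != j -> pblock M i = pblock M j -> pblock M i = [set i; j].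
  move=> ij Eij; apply/esym/eqP; rewrite eqEcard cards2 ij (M2 _ (blkM i)) andbT.
  by apply/subsetP => x; rewrite !inE => /orP[] /eqP -> //; rewrite Eij.
rewrite -{1}(card_initial lekn) -(@card_in_imset _ _ (pblock M)).
  apply/subset_leq_card/subsetP => _ /imsetP[i ik ->]; rewrite inE blkM /=.
  have /subsetPn[j ji jk] := noedge _ (blkM i).
  have ij : i != j by apply: contraNneq jk => <-.
  rewrite (blkE _ _ ij) ?(uM _ _ j (blkM i) (blkM j) ji (iblk j)) //.
  by move: ik jk; rewrite crosses_pair !inE => ->.
move=> i j ik jk Eij; apply/eqP/negPn/negP => ij.
have /negP[] := noedge _ (blkM i); rewrite (blkE _ _ ij Eij).
by apply/subsetP => x; rewrite in_set2 => /orP[] /eqP ->.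
Qed.

End Crossings.

(** * Inserting an edge inside [[3]] *)

Section Extension.

Variables (n : nat) (c : 'I_3).

Lemma skip_subproof (i : 'I_(2 * n)) :
  (if i == 0 :> nat then c : nat else i.+2) < 2 * n.+1.
Proof. by case: i c => i /= Hi [j /= Hj]; case: ifP; lia. Qed.

(* The increasing embedding whose range omits the two points of [[3]] other
   than [c]. *)
Definition skip (i : 'I_(2 * n)) : 'I_(2 * n.+1) := Ordinal (skip_subproof i).

(** For [0 < n] this is [[3]] without [c]; for [n = 0] it is the whole two-point ground set,
    whatever [c] is. Defining it as a complement avoids a case analysis on [c]. *)
Definition new_edge : {set 'I_(2 * n.+1)} := ~: (skip @: setT).

Definition extend (M : {set {set 'I_(2 * n)}}) : {set {set 'I_(2 * n.+1)}} :=
  new_edge |: [set skip @: e | e : {set 'I_(2 * n)} in M].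

Lemma skip_inj : injective skip.
Proof.
move=> i j /(congr1 val) /=; have := ltn_ord c => ltc E; apply: val_inj => /=.
by move: E; case: eqP => [->|]; case: eqP => [->|]; lia.
Qed.

Lemma card_new_edge : #|new_edge| = 2.
Proof.
have := cardsC (skip @: setT); rewrite card_imset; last exact: skip_inj.
rewrite cardsT !card_ord => E; apply: (@addnI (2 * n)).
by apply: etrans E _; rewrite mulnS addnC.
Qed.

Lemma skip_notin i : skip i \notin new_edge.
Proof. by rewrite inE negbK imset_f. Qed.

Lemma notin_new_edge x : x \notin new_edge -> exists i, x = skip i.
Proof. by rewrite inE negbK => /imsetP[i _ ->]; exists i. Qed.

Lemma new_edge_notin_imset (e : {set 'I_(2 * n)}) : new_edge != skip @: e.
Proof.
apply/eqP => E; have : 0 < #|new_edge| by rewrite card_new_edge.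
case/card_gt0P=> x xD; have := xD; rewrite E => /imsetP[i _ Ex].
by have := skip_notin i; rewrite -Ex xD.
Qed.

Lemma mem_extend (M : {set {set 'I_(2 * n)}}) (e : {set 'I_(2 * n)}) :
  (skip @: e \in extend M) = (e \in M).
Proof.
rewrite !inE eq_sym (negPf (new_edge_notin_imset e)) /=.
exact/mem_imset/imset_inj/skip_inj.
Qed.

Lemma extend_inj : injective extend.
Proof. by move=> M1 M2 E; apply/setP => e; rewrite -!mem_extend E. Qed.

Lemma matching_extend (M : {set {set 'I_(2 * n)}}) :
  is_matching M -> is_matching (extend M).
Proof.
move=> /matchingP[M2 cov uM]; apply/matchingP; split.
- move=> e /setU1P[->|/imsetP[e' e'M ->]]; first exact: card_new_edge.
  by rewrite card_imset ?M2 //; exact: skip_inj.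
- move=> x; have [xD|] := boolP (x \in new_edge).
    by exists new_edge; rewrite // setU11.
  case/notin_new_edge => i ->; have [e eM ie] := cov i.
  by exists (skip @: e); rewrite ?mem_extend ?imset_f.
- move=> e1 e2 x /setU1P[->|/imsetP[a aM ->]] /setU1P[->|/imsetP[b bM ->]] //.
  + by move=> xD /imsetP[i _ Ex]; have := skip_notin i; rewrite -Ex xD.
  + by move=> /imsetP[i _ Ex]; have := skip_notin i; rewrite -Ex => /negP.
  + move=> /imsetP[i ia ->] /imsetP[j jb /skip_inj Eij].
    by rewrite (uM a b i) // Eij.
Qed.

(** The other edges are disjoint from [new_edge], hence lie in the range of [skip] and are the
    images of their preimages; these preimages form [M']. *)
Lemma matching_extendP (M : {set {set 'I_(2 * n.+1)}}) :
  is_matching M -> new_edge \in M -> exists2 M', is_matching M' & M = extend M'.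
Proof.
move=> /matchingP[M2 cov uM] DM.
have imM e : e \in M -> e != new_edge -> e = skip @: (skip @^-1: e).
  move=> eM neD; apply/setP => x; apply/idP/imsetP => [xe|[i + ->]]; last first.
    by rewrite inE.
  have [xD|] := boolP (x \in new_edge).
    by case/eqP: neD; apply: uM xe xD.
  by case/notin_new_edge => i Ex; exists i; rewrite // inE -Ex.
exists [set e : {set 'I_(2 * n)} | skip @: e \in M].
  apply/matchingP; split.
  - by move=> e; rewrite inE => /M2; rewrite card_imset //; exact: skip_inj.
  - move=> i; have [e eM ie] := cov (skip i).
    have neD : e != new_edge by apply: contraNneq (skip_notin i) => <-.
    by exists (skip @^-1: e); rewrite inE // -imM.
  - move=> e1 e2 i; rewrite !inE => e1M e2M ie1 ie2.
    by apply: (imset_inj skip_inj); apply: (uM _ _ (skip i)); rewrite ?imset_f.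
apply/setP => e; apply/idP/setU1P => [eM|[->|/imsetP[a + ->]]] //; last first.
  by rewrite inE.
have [|neD] := eqVneq e new_edge; [by left | right].
by apply/imsetP; exists (skip @^-1: e); rewrite ?inE -?imM.
Qed.

Lemma new_edgeI (x : 'I_(2 * n.+1)) : x < 3 -> x != c :> nat -> x \in new_edge.
Proof.
move=> x3 xc; apply: contraNT xc => /notin_new_edge[i Ex]; move: x3; rewrite Ex /=.
by case: ifP => //; lia.
Qed.

(** The bound is 2 for [c = 2] and 3 otherwise: from that cut on, the new edge no longer crosses. *)
Lemma new_edge_lt (x : 'I_(2 * n.+1)) : x \in new_edge -> x < 2 + (c < 2).
Proof.
move=> xD; rewrite ltnNge; apply: contraL xD => lex.
have ltc := ltn_ord c; have ltx := ltn_ord x.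
have ltx2 : x - 2 < 2 * n by lia.
rewrite (_ : x = skip (Ordinal ltx2)) ?skip_notin //.
apply: val_inj => /=; case: ifPn => Hx; last by move: lex; case: (c < 2); lia.
by move: lex; case: ltnP; lia.
Qed.

(* For [c = 2] the shift by two is exact, and [k = 0] is allowed. *)
Lemma crossing_number_extend (M : {set {set 'I_(2 * n)}}) (k : nat) :
  is_matching M -> (c < 2) <= k ->
  crossing_number k.+2 (extend M) = crossing_number k M.
Proof.
move=> /matchingP[M2 _ _] ck; have ltc := ltn_ord c.
(* At [i = 0] the claim is that [c < k.+2] exactly when [0 < k]; for [k = 0] the hypothesis forces
   [c = 2]. *)
have skipk (i : 'I_(2 * n)) : (skip i < k.+2) = (i < k).
  by move: ck => /=; case: eqP => [->|_]; case: ltnP; lia.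
have imC e : e \in M -> crosses k.+2 (skip @: e) = crosses k e.
  move=> /M2/eqP/cards2P[a [b [_ ->]]].
  by rewrite imsetU1 imset_set1 !crosses_pair !skipk.
have DC : ~~ crosses k.+2 new_edge.
  have /eqP/cards2P[a [b [_ E]]] := card_new_edge; rewrite E crosses_pair.
  have := @new_edge_lt a; have := @new_edge_lt b; rewrite E set21 set22.
  move=> /(_ isT) bl /(_ isT) al.
  have -> : a < k.+2 by apply: leq_trans al _; rewrite addSn add1n !ltnS.
  by have -> : b < k.+2 by apply: leq_trans bl _; rewrite addSn add1n !ltnS.
rewrite /crossing_number -(card_imset _ (imset_inj skip_inj)).
apply: eq_card => e; rewrite [in LHS]inE; apply/andP/imsetP => [[]|[a + ->]].
  case/setU1P=> [->|/imsetP[a aM ->]]; first by move/negP: DC.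
  by rewrite imC // => aC; exists a; rewrite // inE aM.
by rewrite inE => /andP[aM aC]; rewrite mem_extend imC.
Qed.

(** The cuts that the shift by two does not reach are too small to exceed [j]. The condition
    [(c < 2) < j] asks for [j >= 2] unless [c = 2], which serves both [j = 1] and [j = 2]. *)
Lemma sock_number_extend (M : {set {set 'I_(2 * n)}}) (j : nat) :
  is_matching M -> 0 < j -> (c < 2) < j ->
  (sock_number (extend M) <= j) = (sock_number M <= j).
Proof.
move=> mM j0 cj; have mE := matching_extend mM.
apply/sock_numberP/sock_numberP => H k.
  case: k => [|k]; last by rewrite -crossing_number_extend // (leq_trans (leq_b1 _)).
  by apply: leq_trans (crossing_number_le mM (leq0n _)) _.
case: k => [|[|k]].
- by apply: leq_trans (crossing_number_le mE (leq0n _)) _.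
- by apply: leq_trans (crossing_number_le mE _) j0; lia.
- have [ck|] := leqP (c < 2) k; first by rewrite crossing_number_extend.
  (* What remains is the cut at 2 with [c < 2], crossed by at most [2 <= j] edges. *)
  case: (c < 2) cj => //= j2; rewrite ltnS leqn0 => /eqP ->.
  by apply: leq_trans (crossing_number_le mE _) j2; lia.
Qed.

End Extension.

(** Two distinct pairs in [[3]] share a point, so as edges of one matching they would coincide; but
    [c] lies in the pair of [d] and not in its own. *)
Lemma new_edge_inj (n : nat) (c d : 'I_3) (M : {set {set 'I_(2 * n)}}) :
  0 < n -> is_matching M -> new_edge n d \in extend c M -> c = d.
Proof.
move=> n0 mM dM; apply/eqP; apply: contraT => cd.
have /matchingP[_ _ uE] := matching_extend c mM.
have ltc := ltn_ord c; have ltd := ltn_ord d.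
have cdn : c != d :> nat by [].
(* Since 0 + 1 + 2 = 3, this is the element of [{0, 1, 2}] other than [c] and [d], common to both
   pairs. *)
have ltz : 3 - (c + d) < 2 * n.+1 by lia.
have ltc' : c < 2 * n.+1 by lia.
have Ecd : new_edge n c = new_edge n d.
  apply: (uE _ _ (Ordinal ltz)); rewrite ?setU11 //; apply: new_edgeI => /=; lia.
have : Ordinal ltc' \in new_edge n d by apply: new_edgeI => /=; lia.
have lt0 : 0 < 2 * n by lia.
rewrite -Ecd (_ : Ordinal ltc' = skip c (Ordinal lt0)) ?(negPf (skip_notin _ _)) //.
exact: val_inj.
Qed.

(** * Recurrences from deleting an edge *)

Definition bounded_matchings (j n : nat) : {set {set {set 'I_(2 * n)}}} :=
  [set M : {set {set 'I_(2 * n)}} | is_matching M & sock_number M <= j].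

Lemma s_le1S (n : nat) : s_le 1 n.+1 = s_le 1 n.
Proof.
rewrite -[RHS](card_imset _ (@extend_inj n ord_max)); apply: eq_card => M.
rewrite inE; apply/andP/imsetP => [[mM M1]|[M' + ->]]; last first.
  rewrite inE => /andP[mM' M'1].
  by rewrite matching_extend // sock_number_extend.
(* With [c = 2] the new edge is [[2]], the only pair that fits inside [[2]]. *)
have DM : new_edge n ord_max \in M.
  have le2 : 2 <= 2 * n.+1 by lia.
  have [e eM e2] := edge_in_initial mM le2 (sock_numberP _ _ M1 2).
  have /matchingP[M2 _ _] := mM.
  rewrite (_ : new_edge _ _ = e) //; apply/esym/eqP.
  rewrite eqEcard card_new_edge M2 // andbT; apply/subsetP => x /(subsetP e2).
  by rewrite inE => x2; apply: new_edgeI => /=; lia.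
have [M' mM' EM] := matching_extendP mM DM; exists M' => //.
by rewrite inE mM' -(sock_number_extend (c := ord_max)) // -EM.
Qed.

Lemma s_le2S (n : nat) : 0 < n -> s_le 2 n.+1 = 3 * s_le 2 n.
Proof.
move=> n0; pose F (p : 'I_3 * {set {set 'I_(2 * n)}}) := extend p.1 p.2.
transitivity #|F @: setX setT (bounded_matchings 2 n)|; last first.
  (* Injectivity: [new_edge_inj] recovers [c] from the extended matching, then [extend_inj] recovers
     [M]. *)
  rewrite card_in_imset ?cardsX ?cardsT ?card_ord // => -[c M] [d N] /=.
  rewrite !inE /= /F /= => /andP[mM _] _ E.
  have Ecd : c = d by apply: (new_edge_inj n0 mM); rewrite E setU11.
  by move: E; rewrite Ecd => /extend_inj ->.
apply: eq_card => M.
rewrite inE; apply/andP/imsetP => [[mM M1]|[[c M'] + ->]]; last first.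
  rewrite !inE /= => /andP[mM' M'1].
  by rewrite matching_extend // sock_number_extend //; case: (c < 2).
have [c DM] : exists c, new_edge n c \in M.
  have le3 : 3 <= 2 * n.+1 by lia.
  have [e eM e3] := edge_in_initial mM le3 (sock_numberP _ _ M1 3).
  have /matchingP[M2 _ _] := mM.
  have /eqP/cards2P[a [b [ab Ee]]] := M2 _ eM.
  have := subsetP e3 a; have := subsetP e3 b.
  rewrite Ee !inE !eqxx orbT => /(_ isT) b3 /(_ isT) a3.
  have abn : a != b :> nat by [].
  (* The index [c] is the point of [[3]] missed by the edge [{a, b}]. *)
  have c3 : 3 - (a + b) < 3 by lia.
  exists (Ordinal c3); rewrite (_ : new_edge _ _ = e) //; apply/esym/eqP.
  rewrite eqEcard card_new_edge M2 // andbT Ee.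
  by apply/subsetP => x; rewrite in_set2 => /orP[] /eqP ->; apply: new_edgeI => /=; lia.
have [M' mM' EM] := matching_extendP mM DM; exists (c, M') => //.
rewrite !inE mM' -(sock_number_extend (c := c)) -?EM //.
by case: (c < 2).
Qed.

(** * Base cases and closed forms *)

(** An uncrossed cut at 1 would put a two-point edge inside [[1]]. *)
Lemma s_le0 (n : nat) : 0 < n -> s_le 0 n = 0.
Proof.
move=> n0; apply/eqP; rewrite cards_eq0; apply/eqP/setP => M; rewrite !inE.
apply/negP => /andP[mM /sock_numberP M0]; have le1 : 1 <= 2 * n by lia.
have [e eM e1] := edge_in_initial mM le1 (M0 1).
have /matchingP[/(_ _ eM) + _ _] := mM.
by have := subset_leq_card e1; rewrite card_initial // => /[swap] ->.
Qed.

Lemma s_leS (j n : nat) : s_le j.+1 n = s_le j n + s_eq j.+1 n.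
Proof.
rewrite /s_le /s_eq -cardsUI.
have -> : [set M : {set {set 'I_(2 * n)}} | is_matching M & sock_number M <= j]
    :&: [set M | is_matching M & sock_number M == j.+1] = set0.
  by apply/setP => M; rewrite !inE; case: eqP => [->|]; rewrite ?ltnn !andbF.
rewrite cards0 addn0; apply: eq_card => M; rewrite !inE -andb_orr.
by rewrite [in LHS]leq_eqVlt orbC ltnS.
Qed.

(** No cut is crossed by more than the [n] edges present. At [n = 1] this reduces [s_le 2 1] to
    [s_le 1 1], the start of the powers of three. *)
Lemma s_le_max (j n : nat) : n <= j -> s_le j n = s_le n n.
Proof.
move=> lenj; apply: eq_card => M; rewrite !inE.
have [mM|//] := boolP (is_matching M).
have Mn : sock_number M <= n.
  by apply/sock_numberP => k; apply: crossing_number_le_edges.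
by rewrite Mn (leq_trans Mn).
Qed.

Lemma s_le_n0 (j : nat) : s_le j 0 = 1.
Proof.
rewrite -(cards1 (set0 : {set {set 'I_(2 * 0)}})); apply: eq_card => M; rewrite !inE.
apply/andP/eqP => [[/matchingP[M2 _ _] _]|->].
  apply/setP => e; rewrite inE; apply/negP => /M2.
  by have := max_card e; rewrite card_ord => /[swap] ->.
have m0 : @is_matching 0 set0.
  by apply/matchingP; split=> [e|[]|e ? ?] //; rewrite inE.
by split=> //; apply/sock_numberP => k;
   apply: leq_trans (crossing_number_le_edges m0 k) _.
Qed.

Lemma s_le1 (n : nat) : s_le 1 n = 1.
Proof. by elim: n => [|n IHn]; rewrite ?s_le_n0 ?s_le1S. Qed.

Lemma s_le2 (n : nat) : s_le 2 n.+1 = 3 ^ n.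
Proof.
elim: n => [|n IHn]; first by rewrite s_le_max // s_le1.
by rewrite s_le2S // IHn expnS.
Qed.

Lemma s_eq1 (n : nat) : 0 < n -> s_eq 1 n = 1.
Proof. by move=> n0; have := s_leS 0 n; rewrite s_le1 s_le0. Qed.

Theorem proposition3p1 :
  [/\ s_le 2 1 = 1,
      (forall n : nat, 2 <= n -> s_le 2 n = 3 * s_le 2 (n - 1)) &
      (forall n : nat, 1 <= n ->
        [/\ s_le 2 n = 3 ^ (n - 1),
            ((s_eq 2 n)%:Z = (s_le 2 n)%:Z - (s_eq 1 n)%:Z)%R &
            ((s_le 2 n)%:Z - (s_eq 1 n)%:Z = 3%:Z ^+ (n - 1)%N - 1)%R])].
Proof.
split; first by rewrite s_le2.
  by case=> [|[|n]] // _; rewrite subn1 /= s_le2S.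
case=> // n _; rewrite subn1 /= s_le2 s_eq1 //; split=> //.
  (* Both [s_le 1] and [s_eq 1] equal 1 here, so the additive split gives the subtraction. *)
  by have := s_leS 1 n.+1; rewrite s_le2 s_le1; lia.
by rewrite -[Posz (3 ^ n)]natz natrX.
Qed.
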